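(* Let $\mathbf G$ be a compact metric graph without cycles. Then $$S_\infty^N(\mathbf G)=\frac{4}{\displaystyle\max_{x,y\in\mathbf G}\operatorname{dist}(x,y)}.$$
   Context: $\mathbf G=\mathbf G(\mathbf V,\mathbf E)$ is a graph with vertex set $\mathbf V$ and edge set $\mathbf E$; it is connected, has finitely many edges, contains no loops, and no vertex has degree $2$. It is a compact metric graph: each edge $\mathbf e$ is identified with an interval $[0,l(\mathbf e)]$ with $0<l(\mathbf e)<\infty$. $\operatorname{dist}$ is the shortest-path distance on $\mathbf G$. A cycle is a closed path consisting of distinct edges and vertices, except for its initial and terminal vertex, which coincide. $H^1(\mathbf G)$ is the space of continuous $u$ on $\mathbf G$ whose restriction to each edge $\mathbf e$ lies in $H^1(\mathbf e)$; $\nabla=\frac{d}{dx}$ on each edge, $\int_{\mathbf G}=\sum_{\mathbf e}\int_0^{l(\mathbf e)}$. $$S_\infty^N(\mathbf G)=\inf\Big\{\int_{\mathbf G}|\nabla u|^2dx:\ u\in H^1(\mathbf G),\ \max_{\mathbf G}u=1,\ \min_{\mathbf G}u=-1\Big\}.$$ *)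

(* Defs.v *)
From HB Require Import structures.
From mathcomp Require Import all_boot all_order all_algebra.
From mathcomp Require Import lra.
From mathcomp Require Import all_classical all_reals all_analysis.

Set Implicit Arguments.
Unset Strict Implicit.
Unset Printing Implicit Defensive.

Import Order.TTheory GRing.Theory Num.Theory.
Import numFieldNormedType.Exports.

Local Open Scope classical_set_scope.
Local Open Scope ring_scope.

(* A finite multigraph.  Edges are undirected: [src] and [tgt] only fix which
   end of an edge carries the parameter 0 and which one the parameter l(e). *)
Record multigraph := Multigraph {
  vertex : finType;
  edge : finType;
  src : edge -> vertex;
  tgt : edge -> vertex
}.

Section Combinatorics.
Variable G : multigraph.
Implicit Types (x y v : vertex G) (e : edge G) (p : seq (edge G * vertex G)).

Definition joins e x y : bool :=
  (src e == x) && (tgt e == y) || (src e == y) && (tgt e == x).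

(* [p] lists the successive (edge, next vertex) pairs of a path issued from x. *)
Fixpoint is_path x p : bool :=
  if p is (e, y) :: p' then joins e x y && is_path y p' else true.

Definition endpoint x p : vertex G := last x (unzip2 p).

Definition connected_graph : Prop :=
  (exists x : vertex G, True) /\
  forall x y, exists2 p, is_path x p & endpoint x p = y.

Definition degree v : nat :=
  (#|[set e | src e == v]%SET| + #|[set e | tgt e == v]%SET|)%N.

(* [unzip2 p] omits the initial occurrence of x, so its duplicate-freeness says
   that only the initial and terminal vertices coincide.  Two parallel edges
   form a cycle. *)
Definition is_cycle x p : Prop :=
  [/\ p != [::], is_path x p, endpoint x p = x,
      uniq (unzip1 p) & uniq (unzip2 p)].

Definition acyclic : Prop := forall x p, ~ is_cycle x p.

End Combinatorics.

Record metric_graph (R : realType) := MetricGraph {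
  graph_of :> multigraph;
  graph_connected : connected_graph graph_of;
  no_loop : forall e : edge graph_of, src e != tgt e;
  no_degree2 : forall v : vertex graph_of, degree v != 2%N;
  len : edge graph_of -> R;
  len_gt0 : forall e, 0 < len e
}.

(* The points of the metric graph: the disjoint union of the intervals
   [0, l(e)] with their end points glued at the vertices. *)
Inductive gpoint (R : realType) (G : metric_graph R) : Type :=
| Vertex of vertex G
| Inner (e : edge G) (t : R) of 0 < t < len e.

HB.instance Definition _ (R : realType) (G : metric_graph R) :=
  gen_eqMixin (gpoint G).
HB.instance Definition _ (R : realType) (G : metric_graph R) :=
  gen_choiceMixin (gpoint G).

Section Metric.
Variables (R : realType) (G : metric_graph R).
Implicit Types (x y z : gpoint G) (e : edge G) (s t L M : R).

(* The identification of [0, l(e)] with e; it is only meant for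
   0 <= t <= l(e), and is constant outside this range. *)
Definition chart e t : gpoint G :=
  match @idP (0 < t < len e) with
  | ReflectT t_in => Inner t_in
  | ReflectF _ => Vertex (if t <= 0 then src e else tgt e)
  end.

(* [route x y L]: x and y are joined by a path of length L, namely a finite
   concatenation of segments each of which lies in a single edge. *)
Inductive route : gpoint G -> gpoint G -> R -> Prop :=
| route_nil x : route x x 0
| route_cons e s t y L : 0 <= s <= len e -> 0 <= t <= len e ->
    route (chart e t) y L -> route (chart e s) y (`|s - t| + L).

Definition gdist x y : R := inf [set L | route x y L].

Lemma chart_src e : chart e 0 = Vertex (src e).
Proof.
rewrite /chart; case: {-}_ / idP => [h|_]; last by rewrite lexx.
by case/andP: (h); rewrite ltxx.
Qed.

Lemma chart_tgt e : chart e (len e) = Vertex (tgt e).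
Proof.
rewrite /chart; case: {-}_ / idP => [h|_]; first by case/andP: (h); rewrite ltxx.
by rewrite leNgt len_gt0.
Qed.

Lemma chart_inner e t (h : 0 < t < len e) : chart e t = Inner h.
Proof.
rewrite /chart; case: {-}_ / idP => [h'|]; last by [].
by congr Inner; exact: bool_irrelevance.
Qed.

Lemma route_ge0 x y L : route x y L -> 0 <= L.
Proof. by elim=> // *; exact: addr_ge0. Qed.

Lemma route_cat x y z L M : route x y L -> route y z M -> route x z (L + M).
Proof.
elim=> [?|e s t y' L' hs ht _ IH /IH h]; first by rewrite add0r.
by rewrite -addrA; exact: route_cons.
Qed.

Lemma route1 e s t : 0 <= s <= len e -> 0 <= t <= len e ->
  route (chart e s) (chart e t) `|s - t|.
Proof.
by move=> hs ht; rewrite -[`|_|]addr0; apply: route_cons => //; exact: route_nil.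
Qed.

Lemma route_sym x y L : route x y L -> route y x L.
Proof.
elim=> [?|e s t y' L' hs ht _ h]; first exact: route_nil.
by rewrite addrC distrC; apply: route_cat h _; exact: route1.
Qed.

Lemma route_edge e : exists L, route (Vertex (src e)) (Vertex (tgt e)) L.
Proof.
exists `|0 - len e|; rewrite -chart_src -chart_tgt.
by apply: route1; rewrite lexx ltW // len_gt0.
Qed.

Lemma route_path (v : vertex G) p : is_path v p ->
  exists L, route (Vertex v) (Vertex (endpoint v p)) L.
Proof.
elim: p v => [|[e w] p IH] v /=; first by move=> _; exists 0; exact: route_nil.
case/andP => hj /IH [M hM]; have [L hL] := route_edge e.
case/orP: hj => /andP[/eqP h1 /eqP h2]; rewrite h1 h2 in hL; exists (L + M).
  exact: route_cat hL hM.
exact: route_cat (route_sym hL) hM.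
Qed.

Lemma route_vertex x : exists v L, route x (Vertex v) L.
Proof.
case: x => [v|e t h]; first by exists v, 0; exact: route_nil.
exists (src e), `|t - 0|; rewrite -chart_inner -chart_src; apply: route1.
  by case/andP: h => h1 h2; rewrite !ltW.
by rewrite lexx ltW // len_gt0.
Qed.

Lemma route_exists x y : exists L, route x y L.
Proof.
have [v [L hL]] := route_vertex x; have [w [M hM]] := route_vertex y.
have [_ /(_ v w) [p /route_path[N hN] pw]] := graph_connected G.
exists (L + (N + M)); apply: route_cat hL _.
by apply: route_cat (route_sym hM); rewrite -pw.
Qed.

Lemma route_has_inf x y : has_inf [set L | route x y L].
Proof.
split; first exact: route_exists.
by exists 0 => L /route_ge0.
Qed.

Lemma gdist_le x y L : route x y L -> gdist x y <= L.
Proof. by move=> h; apply: ge_inf => //; case: (route_has_inf x y). Qed.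

Lemma le_gdist x y M : (forall L, route x y L -> M <= L) -> M <= gdist x y.
Proof. by move=> h; apply: lb_le_inf; [exact: route_exists|move=> L /h]. Qed.

Lemma gdistxx x : gdist x x = 0.
Proof.
apply/eqP; rewrite eq_le gdist_le; last exact: route_nil.
by apply: le_gdist => L /route_ge0.
Qed.

Lemma gdist_sym x y : gdist x y = gdist y x.
Proof. by apply/eqP; rewrite eq_le !le_gdist // => L /route_sym/gdist_le. Qed.

Lemma gdist_triangle y x z : gdist x z <= gdist x y + gdist y z.
Proof.
rewrite -lerBlDr; apply: le_gdist => L hL; rewrite lerBlDr -lerBlDl.
by apply: le_gdist => M hM; rewrite lerBlDl; exact/gdist_le/route_cat/hM.
Qed.

Lemma gdist_lipschitz (f : gpoint G -> R) :
  (forall e s t, 0 <= s <= len e -> 0 <= t <= len e ->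
     f (chart e s) - f (chart e t) <= `|s - t|) ->
  forall x y, f x - f y <= gdist x y.
Proof.
move=> fL x y; apply: le_gdist => L; elim=> [?|e s t y' M hs ht _ IH].
  by rewrite subrr.
by have := lerD (fL _ _ _ hs ht) IH; rewrite addrA subrK.
Qed.

Definition hat_inner e0 t0 x : R :=
  if x is @Inner _ _ e t _ then
    if e == e0 then Num.max 0 (Num.min t0 (len e0 - t0) - `|t - t0|) else 0
  else 0.

Lemma hat_innerE e0 t0 e t : 0 <= t <= len e ->
  hat_inner e0 t0 (chart e t) =
  if e == e0 then Num.max 0 (Num.min t0 (len e0 - t0) - `|t - t0|) else 0.
Proof.
move=> /andP[]; rewrite le_eqVlt => /predU1P[<- _|t0'].
  rewrite chart_src /=; case: eqP => // _; apply/esym/max_idPl.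
  by rewrite subr_le0 sub0r normrN ge_min ler_norm.
rewrite le_eqVlt => /predU1P[->|tl]; last by rewrite chart_inner ?t0'.
rewrite chart_tgt /=; case: eqP => // ->; apply/esym/max_idPl.
by rewrite subr_le0 ge_min ler_norm orbT.
Qed.

Lemma max0_lip (a b c : R) :
  a - b <= c -> 0 <= c -> Num.max 0 a - Num.max 0 b <= c.
Proof.
move=> h c0; rewrite lerBlDr ge_max.
by case: (lerP 0 b) => hb; apply/andP; split; lra.
Qed.

Lemma norm_lip (a b c : R) : `|a - c| - `|b - c| <= `|b - a|.
Proof. by rewrite lerBlDr (distrC b a) ler_distD. Qed.

Lemma gdist_inner_gt0 e t (h : 0 < t < len e) y :
  y <> Inner h -> 0 < gdist (Inner h) y.
Proof.
move=> yx; set r := Num.min t (len e - t).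
have r0 : 0 < r by rewrite lt_min subr_gt0.
have fL : forall x y, hat_inner e t x - hat_inner e t y <= gdist x y.
  apply: gdist_lipschitz => e' s s' hs hs'; rewrite !hat_innerE //.
  case: eqP => _; last by rewrite subrr.
  by apply: max0_lip => //; have := norm_lip s' s t; lra.
apply: lt_le_trans (fL _ _); rewrite /= eqxx subrr normr0 subr0 -/r.
have -> : Num.max 0 r = r by apply/max_idPr/ltW.
rewrite subr_gt0; case: y yx => [v|e' t' h'] //= yx; case: eqP => // ee.
rewrite -/r gt_max r0 /= ltrBlDr ltrDl normr_gt0 subr_eq0.
apply/eqP => tt; apply: yx; subst e' t'; congr Inner; exact: bool_irrelevance.
Qed.

Definition hat_vertex (v : vertex G) r x : R :=
  match x with
  | Vertex w => if w == v then r else 0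
  | @Inner _ _ e t _ =>
    if src e == v then Num.max 0 (r - t)
    else if tgt e == v then Num.max 0 (r - (len e - t)) else 0
  end.

Lemma hat_vertexE (v : vertex G) (r : R) e t : 0 < r <= len e -> 0 <= t <= len e ->
  hat_vertex v r (chart e t) =
  if src e == v then Num.max 0 (r - t)
  else if tgt e == v then Num.max 0 (r - (len e - t)) else 0.
Proof.
move=> /andP[r0 rl] /andP[]; rewrite le_eqVlt => /predU1P[<- _|t0'].
  rewrite chart_src /=; case: eqP => // _.
    by rewrite subr0; apply/esym/max_idPr/ltW.
  by case: eqP => // _; apply/esym/max_idPl; rewrite subr0 subr_le0.
rewrite le_eqVlt => /predU1P[->|tl]; last by rewrite chart_inner ?t0'.
rewrite chart_tgt /=; have := no_loop e; case: (src e =P v) => [->|_ _].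
  rewrite eq_sym => /negbTE ->.
  by apply/esym/max_idPl; rewrite subr_le0.
by case: eqP => // _; rewrite subrr subr0; apply/esym/max_idPr/ltW.
Qed.

Lemma gdist_vertex_gt0 (v w : vertex G) :
  w <> v -> 0 < gdist (Vertex v) (Vertex w).
Proof.
move=> wv; have [r r0 rl] : exists2 r : R, 0 < r & forall e, r <= len e.
  exists (\big[Num.min/1]_(e : edge G) len e).
    by elim/big_ind: _ => // [a b a0 b0|e _]; rewrite ?lt_min ?a0 ?len_gt0.
  by move=> e; rewrite (bigD1 e) //= ge_min lexx.
have fL : forall x y, hat_vertex v r x - hat_vertex v r y <= gdist x y.
  apply: gdist_lipschitz => e s t hs ht; rewrite !hat_vertexE ?r0 ?rl //.
  have h1 := ler_norm (s - t); have h2 := ler_norm (t - s).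
  rewrite distrC in h2.
  case: eqP => _; first by apply: max0_lip => //; lra.
  by case: eqP => _; [apply: max0_lip => //; lra|rewrite subrr].
apply: lt_le_trans (fL _ _); rewrite /= eqxx; case: eqP => // _.
by rewrite subr0.
Qed.

Lemma gdist_positivity x y : gdist x y = 0 -> x = y.
Proof.
move=> d0; apply: contrapT => xy; suff : 0 < gdist x y by rewrite d0 ltxx.
case: x y xy {d0} => [v|e t h] [w|e' t' h'] xy.
- by apply: gdist_vertex_gt0 => wv; apply: xy; rewrite wv.
- by rewrite gdist_sym; exact: gdist_inner_gt0.
- by apply: gdist_inner_gt0 => /esym.
- by apply: gdist_inner_gt0 => /esym.
Qed.

End Metric.

HB.instance Definition _ (R : realType) (G : metric_graph R) :=
  @isMetric.Build R (gpoint G) (@gdist R G) (@gdistxx R G)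
    (@gdist_positivity R G) (@gdist_sym R G) (@gdist_triangle R G).

Lemma mdist_gdist (R : realType) (G : metric_graph R) (x y : gpoint G) :
  mdist x y = gdist x y.
Proof. by []. Qed.

Lemma continuous_gdistP (R : realType) (G : metric_graph R)
    (u : gpoint G -> R) :
  continuous u <-> forall x (eps : R), 0 < eps ->
    exists2 d : R, 0 < d & forall y, gdist x y < d -> `|u x - u y| < eps.
Proof.
have H x := @cvgrPdist_lt R R^o (gpoint G) (nbhs x) (nbhs_filter x) u (u x).
split => [uc x e e0|h x].
  by have /H /(_ _ e0) /nbhs_ballP[d /= d0 hd] := uc x; exists d => // y /hd.
apply/H => e e0; have [d d0 hd] := h x e e0.
by apply/nbhs_ballP; exists d => //= y /hd.
Qed.

Section Sobolev.
Variable R : realType.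
Local Notation mu := (@lebesgue_measure R).
Implicit Types (l : R) (f g phi : R -> R).

Definition square_integrable l f : Prop :=
  measurable_fun `]0, l[ f /\
  mu.-integrable `]0, l[ (fun t => (f t ^+ 2)%:E).

(* phi is C^1 with compact support in ]0, l[. *)
Definition test_function l phi : Prop :=
  [/\ forall t : R, derivable phi t 1,
      continuous (phi^`())%classic &
      exists a b : R, [/\ 0 < a, b < l &
        forall t : R, t \notin `[a, b] -> phi t = 0]].

(* g is the derivative of f on ]0, l[ in the sense of distributions, and is
   square integrable.  It is unique up to almost everywhere equality.  Testing
   against C^1 or against smooth functions gives the same notion. *)
Definition weak_derivative l f g : Prop :=
  square_integrable l g /\
  forall phi, test_function l phi ->
    \int[mu]_(t in `]0, l[) (f t * (phi^`())%classic t) =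
    - \int[mu]_(t in `]0, l[) (g t * phi t).

Definition H1_interval l f : Prop :=
  square_integrable l f /\ exists g, weak_derivative l f g.

Variable G : metric_graph R.

(* Continuity is with respect to the metric [gdist]. *)
Definition H1 (u : gpoint G -> R) : Prop :=
  continuous u /\ forall e, H1_interval (len e) (u \o chart e).

(* On the edge e, nabla u is represented by g e. *)
Definition gradient (u : gpoint G -> R) (g : edge G -> R -> R) : Prop :=
  forall e, weak_derivative (len e) (u \o chart e) (g e).

Definition max_is (u : gpoint G -> R) (a : R) : Prop :=
  range u a /\ ubound (range u) a.

Definition min_is (u : gpoint G -> R) (a : R) : Prop :=
  range u a /\ lbound (range u) a.

Definition energy (g : edge G -> R -> R) : \bar R :=
  (\sum_(e : edge G) \int[mu]_(t in `]0%R, len e[) (`|g e t| ^+ 2)%:E)%E.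

(* The infimum of the empty set is +oo; this only matters for the graph reduced
   to a single vertex. *)
Definition S_infty_N : \bar R :=
  ereal_inf [set a | exists (u : gpoint G -> R) (g : edge G -> R -> R),
    [/\ H1 u, gradient u g, max_is u 1, min_is u (- 1) & a = energy g]].

End Sobolev.

(* Main.v *)
Require Import Defs.
From mathcomp Require Import all_boot all_order all_algebra.
From mathcomp Require Import lra.
From mathcomp Require Import all_classical all_reals all_analysis.
From mathcomp Require Import measurable_realfun.
Import Order.TTheory GRing.Theory Num.Theory.
Import numFieldNormedType.Exports.
Local Open Scope classical_set_scope.
Local Open Scope ring_scope.

Set Implicit Arguments.
Unset Strict Implicit.
Unset Printing Implicit Defensive.

(** On a tree, each edge e carries a coordinate, the nearest-point projection
    [proj e] of the tree onto e seen as an interval.  A route that moves inside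
    one edge changes only the coordinate along that edge, and a simple path
    crosses exactly the edges that separate its ends.  Hence the distance of two
    points is the sum over the edges of the differences of their coordinates
    ([gdistE]); it is convex along each edge, so the diameter d is realized by
    two vertices ([diameter_vertices]).

    Lower bound on the energy.  For the same reason, an increment u p - u q is
    the sum over e of the increments of u between the projections of p and q on
    e ([telescope]).  On an edge, the increment of u between a and b is at most
    lam / 2 times the energy of u on e, plus |b - a| / (2 lam), for every
    lam > 0 ([weak_derivative_le]).  This comes from testing the weak derivative
    against smoothed indicators of [a, b], without representing u as a
    primitive of its weak derivative.  If u p = 1 and u q = -1, summing over the
    edges gives 2 <= lam E / 2 + dist(p, q) / (2 lam), and lam = dist(p, q) / 2
    yields E >= 4 / dist(p, q) >= 4 / d ([energy_ge]).

    Upper bound.  Let v and w be vertices at distance d.  The function which is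
    affine from -1 to 1 along the path from v to w, and constant on the branches
    leaving that path, has slope 2 / d on a set of length d, hence energy 4 / d
    ([energy_attained]).

    If d = 0 the graph is a point, no function takes both values 1 and -1, and
    both sides are +oo. *)

(** * Simple paths and the two sides of an edge *)

Section Paths.
Variable G : multigraph.
Implicit Types (x y v : vertex G) (e : edge G) (p : seq (edge G * vertex G)).

Lemma joinsC e x y : joins e x y = joins e y x.
Proof. by rewrite /joins orbC. Qed.

Definition adj (P : pred (edge G)) : rel (vertex G) :=
  fun x y => [exists e, P e && joins e x y].

Lemma adj_joins (P : pred (edge G)) e x y : P e -> joins e x y -> adj P x y.
Proof. by move=> Pe j; apply/existsP; exists e; rewrite Pe. Qed.

Lemma connect_adj_sym (P : pred (edge G)) : connect_sym (adj P).
Proof.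
apply: sym_connect_sym => x y.
by rewrite /adj; under eq_existsb do rewrite joinsC.
Qed.

Lemma is_path_connect x p : is_path x p -> connect (adj predT) x (endpoint x p).
Proof.
elim: p x => [|[e y] p IH] x /=; first by rewrite connect0.
case/andP=> j /IH; apply: connect_trans; apply: connect1.
exact: adj_joins j.
Qed.

Lemma connect_simple_path (P : pred (edge G)) x y : connect (adj P) x y ->
  exists p, [/\ is_path x p, endpoint x p = y, uniq (x :: unzip2 p) &
                all P (unzip1 p)].
Proof.
case/connectP=> q0 /shortenP[q pq uq _ {q0}] ->.
suff [p [hp qE hP]] : exists p, [/\ is_path x p, unzip2 p = q & all P (unzip1 p)].
  by exists p; split; rewrite /endpoint ?qE.
elim: q x pq {uq} => [|z q IH] x /=; first by exists [::].
case/andP=> /existsP[e /andP[Pe j]] /IH[p [hp hq hP]].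
by exists ((e, z) :: p); split=> /=; rewrite ?j ?hp ?hq ?Pe.
Qed.

(** An edge used by a path has both ends among the vertices of the path, so
    a path that never returns to x uses no edge at x. *)
Lemma joins_notin_path e x z y p :
  joins e x z -> is_path y p -> x \notin y :: unzip2 p -> e \notin unzip1 p.
Proof.
move=> j; elim: p y => [//|[e' w] p IH] y /= /andP[j' hp].
rewrite !inE !negb_or => /and3P[xy xw xp].
rewrite (IH w) ?inE ?negb_or ?xw // andbT.
apply/eqP => ee; subst e'; move: j j' xy xw; rewrite /joins.
by case/orP=> /andP[/eqP-> /eqP->] /orP[] /andP[h1 h2]; rewrite ?h1 ?h2.
Qed.

Lemma uniq_edges x p : is_path x p -> uniq (x :: unzip2 p) -> uniq (unzip1 p).
Proof.
elim: p x => [//|[e y] p IH] x /= /andP[j hp] /andP[xp up].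
by rewrite (joins_notin_path j hp xp) (IH y).
Qed.

Definition side e v := connect (adj (predC1 e)) (src e) v.

Lemma side_src e : side e (src e).
Proof. exact: connect0. Qed.

(** In a graph without cycles an edge is the only link between its ends: a
    simple path avoiding e from one end to the other would close up with e. *)
Lemma side_tgt e : acyclic G -> side e (tgt e) = false.
Proof.
move=> acy; apply/negP => /connect_simple_path[p [hp ep up hP]].
apply: (acy (tgt e) ((e, src e) :: p)); split => //=.
- by rewrite hp /joins !eqxx orbT.
- rewrite (uniq_edges hp up) andbT.
  by apply/negP => /(allP hP); rewrite /= eqxx.
Qed.

Lemma side_joins e e' x y : e' != e -> joins e' x y -> side e x = side e y.
Proof.
move=> ee j; apply: same_connect_r; first exact: connect_adj_sym.
by apply: connect1; exact: adj_joins j.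
Qed.

Lemma side_path e x p : is_path x p -> e \notin unzip1 p ->
  side e x = side e (endpoint x p).
Proof.
elim: p x => [//|[e' y] p IH] x /= /andP[j hp].
rewrite inE negb_or eq_sym => /andP[ee /(IH _ hp) <-].
exact: side_joins j.
Qed.

End Paths.

(** * Coordinates on a tree *)

Section Tree.
Variables (R : realType) (G : metric_graph R).
Implicit Types (x y z : gpoint G) (e : edge G) (v w : vertex G) (s t : R).

Definition vproj e v : R := if side e v then 0 else len e.

(** The nearest-point projection of G onto the edge e, in the parameter of e. *)
Definition proj e z : R :=
  match z with
  | Vertex v => vproj e v
  | @Inner _ _ e' t _ => if e' == e then t else vproj e (src e')
  end.

Definition l1dist x y : R := \sum_(e : edge G) `|proj e x - proj e y|.

Lemma chart_cases (P : edge G -> R -> gpoint G -> Prop) :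
  (forall e, P e 0 (Vertex (src e))) ->
  (forall e, P e (len e) (Vertex (tgt e))) ->
  (forall e t (h : 0 < t < len e), P e t (Inner h)) ->
  forall e t, 0 <= t <= len e -> P e t (chart e t).
Proof.
move=> P0 P1 Pt e t /andP[]; rewrite le_eqVlt => /predU1P[<- _|t0].
  by rewrite chart_src.
rewrite le_eqVlt => /predU1P[->|tl]; first by rewrite chart_tgt.
have h : 0 < t < len e by rewrite t0 tl.
by rewrite chart_inner.
Qed.

Lemma gpoint_chart z : (exists v, z = Vertex v) \/
  exists e t, 0 < t < len e /\ z = chart e t.
Proof.
case: z => [v|e t h]; first by left; exists v.
by right; exists e, t; rewrite chart_inner.
Qed.

Lemma proj_itv e z : 0 <= proj e z <= len e.
Proof.
have l0 := ltW (len_gt0 e).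
have vE v : 0 <= vproj e v <= len e by rewrite /vproj; case: ifP; rewrite lexx l0.
case: z => [v|e' t h] //=; case: eqP => // ee; subst e'.
by case/andP: h => h1 h2; rewrite !ltW.
Qed.

Lemma gdist_chart_src e t : 0 <= t <= len e ->
  gdist (chart e t) (Vertex (src e)) <= t.
Proof.
move=> ht; rewrite -chart_src; have /andP[t0 _] := ht.
rewrite -[leRHS](ger0_norm t0) -[X in `|X|](subr0 t); apply/gdist_le/route1 => //.
by rewrite lexx ltW // len_gt0.
Qed.

Lemma gdist_chart_tgt e t : 0 <= t <= len e ->
  gdist (chart e t) (Vertex (tgt e)) <= len e - t.
Proof.
move=> ht; rewrite -chart_tgt; have /andP[_ t1] := ht.
rewrite -[leRHS]ger0_norm ?subr_ge0 // distrC; apply/gdist_le/route1 => //.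
by rewrite lexx ltW // len_gt0.
Qed.

Lemma l1distC x y : l1dist x y = l1dist y x.
Proof. by apply: eq_bigr => e _; rewrite distrC. Qed.

Lemma vproj_end e v : vproj e v = 0 \/ vproj e v = len e.
Proof. by rewrite /vproj; case: ifP; [left|right]. Qed.

Hypothesis acy : acyclic G.

Lemma vproj_src e : vproj e (src e) = 0.
Proof. by rewrite /vproj side_src. Qed.

Lemma vproj_tgt e : vproj e (tgt e) = len e.
Proof. by rewrite /vproj side_tgt. Qed.

Lemma vproj_joins e e' v w : e' != e -> joins e' v w -> vproj e v = vproj e w.
Proof. by move=> ee j; rewrite /vproj (side_joins ee j). Qed.

Lemma proj_chart e e' t : 0 <= t <= len e' ->
  proj e (chart e' t) = if e' == e then t else vproj e (src e').
Proof.
move: e' t; apply: (@chart_cases (fun e' t z =>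
  proj e z = if e' == e then t else vproj e (src e'))) => e' //=.
  by case: eqP => // ->; rewrite vproj_src.
case: eqP => [->|/eqP ee]; first by rewrite vproj_tgt.
by apply/esym/(vproj_joins ee); rewrite /joins !eqxx.
Qed.

(** Moving inside an edge changes only the coordinate along that edge, so a sum
    of functions of the coordinates varies through a single term. *)
Lemma sum_proj_chart (F : edge G -> R -> R) e s t :
  0 <= s <= len e -> 0 <= t <= len e ->
  \sum_e' (F e' (proj e' (chart e s)) - F e' (proj e' (chart e t))) =
  F e s - F e t.
Proof.
move=> hs ht; rewrite (bigD1 e) //= !proj_chart // eqxx big1 ?addr0 // => e' ee.
by rewrite !proj_chart // eq_sym (negbTE ee) subrr.
Qed.

Lemma l1dist_le_gdist x y : l1dist x y <= gdist x y.
Proof.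
have /(@gdist_lipschitz _ G (l1dist^~ y)) /(_ x y) : forall e s t,
    0 <= s <= len e -> 0 <= t <= len e ->
    l1dist (chart e s) y - l1dist (chart e t) y <= `|s - t|.
  move=> e s t hs ht; rewrite -sumrB.
  rewrite (sum_proj_chart (fun e' r => `|r - proj e' y|)) //.
  by rewrite [leRHS]distrC; exact: norm_lip.
by rewrite [l1dist y y]big1 ?subr0 // => e _; rewrite subrr normr0.
Qed.

(** A simple path crosses each edge it uses exactly once, and these are
    precisely the edges separating its ends: the first edge e of the path is
    never used again, so the rest of the path stays on one side of e. *)
Lemma gdist_path_le v p : is_path v p -> uniq (v :: unzip2 p) ->
  gdist (Vertex v) (Vertex (endpoint v p)) <=
  l1dist (Vertex v) (Vertex (endpoint v p)).
Proof.
elim: p v => [|[e w] p IH] v /=.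
  by move=> _ _; rewrite gdistxx sumr_ge0.
move=> /andP[j hp] /andP[vp up]; set z := endpoint w p.
have ep := joins_notin_path j hp vp.
have ezw : vproj e w = vproj e z by rewrite /vproj (side_path hp ep).
have gvw : gdist (Vertex v) (Vertex w) <= `|vproj e v - vproj e w|.
  have l0 := ltW (len_gt0 e).
  case/orP: j => /andP[/eqP <- /eqP <-]; rewrite vproj_src vproj_tgt.
    by rewrite sub0r normrN ger0_norm // gdist_sym -chart_tgt gdist_chart_src ?l0 ?lexx.
  by rewrite subr0 ger0_norm // -chart_tgt gdist_chart_src ?l0 ?lexx.
apply: le_trans (gdist_triangle (Vertex w) _ _) _.
apply: le_trans (lerD gvw (IH _ hp up)) _.
rewrite /l1dist (bigD1 e) //= [leRHS](bigD1 e) //= -/z ezw subrr normr0 add0r.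
rewrite lerD2l ler_sum // => e' ee.
by rewrite (@vproj_joins e' e v w) // eq_sym.
Qed.

Lemma gdist_vertex_le v w : gdist (Vertex v) (Vertex w) <= l1dist (Vertex v) (Vertex w).
Proof.
have [_ /(_ v w)[p hp <-]] := graph_connected G.
have /connect_simple_path[q [hq <- uq _]] := is_path_connect hp.
exact: gdist_path_le.
Qed.

(** When z does not lie inside the edge e, the way from a point of e to z
    leaves e through the end onto which z is projected. *)
Lemma gdist_chart_le e t z : 0 <= t <= len e ->
  proj e z = 0 \/ proj e z = len e ->
  (forall v, gdist (Vertex v) z <= l1dist (Vertex v) z) ->
  gdist (chart e t) z <= l1dist (chart e t) z.
Proof.
move=> ht hz hv.
have step v : gdist (chart e t) (Vertex v) <= `|t - proj e z| ->
    proj e z = vproj e v -> (forall e', e != e' -> vproj e' v = vproj e' (src e)) ->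
    gdist (chart e t) z <= l1dist (chart e t) z.
  move=> h1 h2 h3; apply: le_trans (gdist_triangle (Vertex v) _ _) _.
  apply: le_trans (lerD h1 (hv v)) _.
  rewrite /l1dist (bigD1 e) //= [leRHS](bigD1 e) //= h2 subrr normr0 add0r.
  rewrite proj_chart // eqxx lerD2l ler_sum // => e' ee.
  by rewrite proj_chart // eq_sym (negbTE ee) h3 // eq_sym.
have /andP[t0 t1] := ht.
case: hz => hz.
  apply: (step (src e)); rewrite ?hz ?vproj_src // subr0 ger0_norm //.
  exact: gdist_chart_src.
apply: (step (tgt e)); rewrite ?hz ?vproj_tgt //.
  by rewrite distrC ger0_norm ?subr_ge0 // gdist_chart_tgt.
by move=> e' ee; apply/esym/(vproj_joins ee); rewrite /joins !eqxx.
Qed.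

(** The l1 distance of the coordinates is 1-Lipschitz along edges, hence at most
    the distance.  Conversely, a point inside an edge can leave it through the
    end facing the other point, which reduces to simple paths of vertices. *)
Lemma gdistE x y : gdist x y = l1dist x y.
Proof.
apply/eqP; rewrite eq_le l1dist_le_gdist andbT.
have hv z v : gdist (Vertex v) z <= l1dist (Vertex v) z.
  rewrite gdist_sym l1distC.
  case: (gpoint_chart z) => [[w ->]|[e [t [/andP[t0 t1] ->]]]].
    exact: gdist_vertex_le.
  apply: gdist_chart_le => [||w]; first by rewrite !ltW.
    exact: vproj_end.
  exact: gdist_vertex_le.
case: (gpoint_chart x) => [[w ->]|[e [s [hs ->]]]]; first exact: hv.
have {}hs : 0 <= s <= len e by case/andP: hs => ? ?; rewrite !ltW.
case: (gpoint_chart y) => [[w ->]|[e' [t [ht ->]]]].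
  by apply: gdist_chart_le => //; exact: vproj_end.
have {}ht : 0 <= t <= len e' by case/andP: ht => ? ?; rewrite !ltW.
have [ee|ee] := eqVneq e' e.
  subst e'; rewrite /l1dist (bigD1 e) //= !proj_chart // eqxx.
  apply: le_trans (gdist_le (route1 hs ht)) _.
  by rewrite lerDl sumr_ge0.
by apply: gdist_chart_le => //; rewrite proj_chart // (negbTE ee); exact: vproj_end.
Qed.

(** The distance to a fixed point is convex along an edge, hence maximal at one
    of its ends. *)
Lemma gdist_le_end x y : exists v, gdist x y <= gdist (Vertex v) y.
Proof.
case: (gpoint_chart x) => [[v ->]|[e [t [/andP[t0 t1] ->]]]]; first by exists v.
have ht : 0 <= t <= len e by rewrite !ltW.
have step s : 0 <= s <= len e -> `|t - proj e y| <= `|s - proj e y| ->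
    gdist (chart e t) y <= gdist (chart e s) y.
  move=> hs h; rewrite !gdistE /l1dist (bigD1 e) //= [leRHS](bigD1 e) //=.
  rewrite !proj_chart // eqxx lerD // ler_sum // => e' ee.
  by rewrite !proj_chart // eq_sym (negbTE ee).
have /andP[p0 p1] := proj_itv e y.
have l0 := ltW (len_gt0 e).
case: (lerP t (proj e y)) => htp.
  exists (src e); rewrite -chart_src step ?lexx ?l0 //.
  by rewrite !ler0_norm; lra.
exists (tgt e); rewrite -chart_tgt step ?lexx ?l0 //.
by rewrite !ger0_norm; lra.
Qed.

(** By convexity a diameter is realized at two vertices, so its existence is a
    matter of finiteness rather than compactness. *)
Lemma diameter_vertices : exists v w : vertex G,
  forall x y, gdist x y <= gdist (Vertex v) (Vertex w).
Proof.
have [[v0 _] _] := graph_connected G.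
pose F (q : vertex G * vertex G) := gdist (Vertex q.1) (Vertex q.2) : R.
case: (@arg_maxP _ R _ (v0, v0) xpredT F isT) => -[v w] _ hm.
exists v, w => x y.
have [x' hx] := gdist_le_end x y; apply: le_trans hx _; rewrite gdist_sym.
have [y' hy] := gdist_le_end y (Vertex x'); apply: le_trans hy _.
rewrite gdist_sym; exact: (hm (x', y') isT).
Qed.

End Tree.

(** * Weak derivatives on an interval *)

Section Interval.
Variable R : realType.
Local Notation mu := (@lebesgue_measure R).
Implicit Types (f g h F U phi : R -> R) (l k s t eps eta lam : R).

Lemma integrable_continuous l f : continuous f ->
  mu.-integrable `]0, l[ (EFin \o f).
Proof.
move=> cf; apply: (@integrableS _ _ _ mu `[0, l]%classic) => //.
  exact: subset_itv_oo_cc.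
apply: continuous_compact_integrable; first exact: segment_compact.
exact: continuous_subspaceT.
Qed.

Lemma Rintegral_derivative l F f : 0 < l ->
  (forall t : R, is_derive t 1 F (f t)) -> continuous f ->
  \int[mu]_(t in `]0, l[) f t = F l - F 0.
Proof.
move=> l0 dF cf.
have mf : mu.-integrable `]0, l[ (EFin \o f) by exact: integrable_continuous.
rewrite /Rintegral -(@integral_itv_bndoo _ _ _ _ true false); last first.
  by case/integrableP: mf.
rewrite (@continuous_FTC2 _ f F) //; first exact: continuous_subspaceT.
  have cF : continuous F.
    move=> t; apply: differentiable_continuous.
    by apply/derivable1_diffP; case: (dF t).
  split; first by move=> t _; case: (dF t).
    by apply: cvg_at_right_filter; exact: cF.
  by apply: cvg_at_left_filter; exact: cF.
by move=> t _; rewrite derive1E; exact: derive_val.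
Qed.

(** Integration by parts: the boundary terms vanish because test functions are
    zero near the ends of ]0, l[. *)
Lemma affine_weak_derivative l f c k : 0 < l ->
  (forall t, 0 < t < l -> f t = c + k * t) ->
  square_integrable l f /\ weak_derivative l f (cst k).
Proof.
move=> l0 fE.
have square_cont h : continuous h -> square_integrable l h.
  move=> ch; split; last first.
    apply: (@integrable_continuous l (fun t => h t ^+ 2)) => t.
    by apply: continuousM; exact: ch.
  by apply/measurable_EFinP; case/integrableP: (integrable_continuous l ch).
pose h t := c + k * t.
have ch : continuous h.
  by move=> t; apply: cvgD; [exact: cvg_cst|apply: cvgM; [exact: cvg_cst|exact: cvg_id]].
have fh : {in `]0, l[%classic, f =1 h}.
  by move=> t; rewrite inE /= in_itv /= => /fE.
split; first split.
- apply: (eq_measurable_fun h); first by move=> t /fh.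
  by case: (square_cont h ch).
- apply: (@eq_integrable _ _ _ mu _ _ (EFin \o (fun t => h t ^+ 2))) => //.
    by move=> t /fh /= ->.
  by case: (square_cont h ch).
split; first by apply: square_cont => t; exact: cvg_cst.
move=> phi [dphi cphi [a [b [a0 bl phi0]]]].
have cph : continuous phi.
  by move=> t; apply: differentiable_continuous; apply/derivable1_diffP.
have dh t : is_derive t 1 h k.
  have := is_deriveD (is_derive_cst c t 1) (is_deriveZ k (is_derive_id t (1 : R))).
  by rewrite add0r /GRing.scale /= mulr1.
have dF t : is_derive t 1 (h * phi) (h t * (phi^`())%classic t + k * phi t).
  have dp : is_derive t 1 phi ((phi^`())%classic t).
    by split => //; rewrite derive1E.
  have := is_deriveM (dh t) dp.
  by rewrite /GRing.scale /= [phi t * k]mulrC.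
have c1 : continuous (fun t => h t * (phi^`())%classic t).
  by move=> t; apply: cvgM; [exact: ch|exact: cphi].
have c2 : continuous (fun t => k * phi t).
  by move=> t; apply: cvgM; [exact: cvg_cst|exact: cph].
have hphiE t : (h * phi) t = h t * phi t by [].
have := Rintegral_derivative l0 dF.
rewrite /= !hphiE (phi0 0) ?(phi0 l) ?in_itv /= ?negb_and -?ltNge ?a0 ?bl ?orbT //.
rewrite !mulr0 subrr RintegralD //; [|exact: integrable_continuous..].
move=> IBP; apply/eqP; rewrite -addr_eq0; apply/eqP; rewrite -[RHS]IBP; last first.
  by move=> t; apply: cvgD; [exact: c1|exact: c2].
congr (_ + _); apply: eq_Rintegral => t /fh /= ->; by [].
Qed.

(** This form applies at once to t |-> max(0, t)^2, including at 0 where its two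
    polynomial pieces meet. *)
Lemma is_derive_quadratic F f :
  (forall s t, `|F t - F s - f s * (t - s)| <= (t - s) ^+ 2) ->
  forall s, is_derive s 1 F (f s).
Proof.
move=> FQ s.
have H : h^-1 *: ((F \o shift s) (h *: 1) - F s) @[h --> 0^'] --> f s.
  apply/cvgrPdist_le => /= e e0; near=> h.
  have h0 : h != 0 by near: h; exact: nbhs_dnbhs_neq.
  rewrite distrC /GRing.scale /= mulr1.
  have -> : h^-1 * (F (h + s) - F s) - f s =
            h^-1 * (F (h + s) - F s - f s * (h + s - s)).
    by rewrite addrK [RHS]mulrBr mulrCA mulVf // mulr1.
  rewrite normrM normfV.
  apply: le_trans (ler_wpM2l _ (FQ s (h + s))) _; first by rewrite invr_ge0.
  rewrite addrK -[h ^+ 2]real_normK ?num_real // expr2 mulrA mulVf ?normr_eq0 // mul1r.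
  near: h; exact: dnbhs0_le.
split; first by apply/cvg_ex; exists (f s).
by apply: cvg_lim.
Unshelve. all: by end_near. Qed.

(** A C^1 step around c: second difference of the C^1 function
    t |-> max(0, t)^2, whose derivative is a hat function. *)
Lemma smooth_step c eps : 0 < eps -> exists F f,
  [/\ forall t : R, is_derive t 1 F (f t), continuous f,
      forall t, 0 <= f t & forall t, eps < `|t - c| -> f t = 0] /\
  [/\ forall t, 0 <= F t <= 1, forall t, t <= c - eps -> F t = 0 &
      forall t, c + eps <= t -> F t = 1].
Proof.
move=> e0.
pose p (t : R) := Num.max 0 t; pose q (t : R) := p t ^+ 2.
have p0 t : t <= 0 -> p t = 0 by move=> h; apply/max_idPl.
have p1 t : 0 <= t -> p t = t by move=> h; apply/max_idPr.
have pE t : (t <= 0 /\ p t = 0) \/ (0 <= t /\ p t = t).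
  by have [h|/ltW h] := leP 0 t; [right|left]; split => //; [exact: p1|exact: p0].
have dq t : is_derive t 1 q (2 * p t).
  move: t; apply: is_derive_quadratic => s t; rewrite /q ler_norml.
  have h1 := sqr_ge0 s; have h2 := sqr_ge0 t; have h3 := sqr_ge0 (t - s).
  by have [[hs ->]|[hs ->]] := pE s; have [[ht ->]|[ht ->]] := pE t;
    apply/andP; split; nra.
have cp : continuous p.
  by move=> t; apply: continuous_max; [exact: cvg_cst|exact: cvg_id].
pose w := (2 * eps ^+ 2)^-1.
have w0 : 0 < w by rewrite invr_gt0 mulr_gt0 // exprn_gt0.
have wE : w * (2 * eps ^+ 2) = 1 by rewrite mulVf // gt_eqF // mulr_gt0 // exprn_gt0.
pose F (t : R) := w * (q (t - (c - eps)) + - 2 * q (t - c) + q (t - (c + eps))).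
pose f (t : R) :=
  w * (2 * p (t - (c - eps)) + - 2 * (2 * p (t - c)) + 2 * p (t - (c + eps))).
have dsh a t : is_derive t 1 (fun t => q (t - a)) (2 * p (t - a)).
  have dB : is_derive t 1 (fun t : R => t - a) 1.
    by have := is_deriveB (is_derive_id t (1 : R)) (is_derive_cst a t 1); rewrite subr0.
  by have := @is_derive1_comp _ q _ _ _ _ (dq _) dB; rewrite mulr1.
have csh a : continuous (fun t => p (t - a)).
  move=> t; apply: (@continuous_comp _ _ _ (fun t => t - a) p); last exact: cp.
  by apply: cvgB; [exact: cvg_id|exact: cvg_cst].
exists F, f; split; split.
- move=> t; have := is_deriveZ w (is_deriveD (is_deriveD (dsh (c - eps) t)
    (is_deriveZ (-2) (dsh c t))) (dsh (c + eps) t)).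
  by rewrite /GRing.scale /=.
- move=> t; apply: cvgM; first exact: cvg_cst.
  apply: cvgD; first apply: cvgD.
  + by apply: cvgM; [exact: cvg_cst|exact: csh].
  + apply: cvgM; [exact: cvg_cst|apply: cvgM; [exact: cvg_cst|exact: csh]].
  + by apply: cvgM; [exact: cvg_cst|exact: csh].
- move=> t; rewrite /f; apply: mulr_ge0; first exact: ltW.
  have [[? ->]|[? ->]] := pE (t - (c - eps)); have [[? ->]|[? ->]] := pE (t - c);
  have [[? ->]|[? ->]] := pE (t - (c + eps)); lra.
- move=> t; rewrite ltr_normr => /orP ht.
  apply/eqP; rewrite mulf_eq0; apply/orP; right; apply/eqP.
  have [[? ->]|[? ->]] := pE (t - (c - eps)); have [[? ->]|[? ->]] := pE (t - c);
  have [[? ->]|[? ->]] := pE (t - (c + eps)); case: ht => ht; lra.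
- move=> t; rewrite -wE /F ler_pM2l // pmulr_rge0 // /q.
  have [s [-> -> ->]] : exists s,
      [/\ t - (c - eps) = s + eps, t - c = s & t - (c + eps) = s - eps].
    by exists (t - c); split; lra.
  have h0 := sqr_ge0 eps.
  have [[h1 ->]|[h1 ->]] := pE (s + eps); have [[h2 ->]|[h2 ->]] := pE s;
  have [[h3 ->]|[h3 ->]] := pE (s - eps); try (apply/andP; split; lra).
  + have h4 := mulr_ge0 h1 h1; have h5 : 0 <= - s by lra.
    have h6 := mulr_ge0 h5 h1; have h7 := mulr_ge0 h5 (ltW e0).
    by apply/andP; split; lra.
  + have h4 : 0 <= eps - s by lra.
    have h5 := mulr_ge0 h2 h4; have h6 := mulr_ge0 h4 h4.
    have h7 := mulr_ge0 h2 (ltW e0); have h8 := mulr_ge0 (ltW e0) (ltW e0).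
    by apply/andP; split; lra.
- move=> t ht; rewrite /F /q !p0; [|lra..].
  by rewrite expr0n /= mulr0 !addr0 mulr0.
- move=> t ht; rewrite -wE /F /q; congr (_ * _).
  by rewrite !p1; lra.
Qed.

Lemma Rintegral_indic_itv l a b : 0 < a -> a <= b -> b < l ->
  mu.-integrable `]0, l[ (EFin \o \1_`[a, b]) /\
  \int[mu]_(t in `]0, l[) \1_`[a, b] t = b - a.
Proof.
move=> a0 ab bl; split.
  apply: (@integrableS _ _ _ mu setT) => //.
  exact: (integrable_indic_itv a b true false).
have sub : `[a, b]%classic `<=` `]0, l[%classic.
  by apply: subset_itv; rewrite bnd_simp.
rewrite /Rintegral integral_indic //= (setIidl sub) lebesgue_measure_itv /=.
rewrite lte_fin; move: ab; rewrite le_eqVlt => /predU1P[->|->] //=.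
by rewrite ltxx subrr.
Qed.

Lemma square_integrable_mul l g phi : square_integrable l g -> continuous phi ->
  (forall t, `|phi t| <= 1) ->
  mu.-integrable `]0, l[ (EFin \o (fun t => g t * phi t)).
Proof.
move=> [mg ig] cphi phi1.
have i1 : mu.-integrable `]0, l[ (EFin \o (fun t => g t ^+ 2 + 1)).
  have := integrableD _ ig (@integrable_continuous l (cst 1) (fun=> cvg_cst _)).
  exact.
apply: le_integrable i1 => //.
  apply/measurable_EFinP; apply: measurable_funM => //.
  by apply/measurable_EFinP; case/integrableP: (integrable_continuous l cphi).
move=> t _ /=; rewrite lee_fin normrM.
apply: le_trans (ler_wpM2l (normr_ge0 _) (phi1 t)) _; rewrite mulr1.
rewrite [leRHS]ger0_norm ?addr_ge0 ?sqr_ge0 // -[g t ^+ 2]real_normK ?num_real //.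
have h1 := sqr_ge0 (`|g t| - 1); have h2 := sqr_ge0 `|g t|; lra.
Qed.

Lemma young lam (x y : R) : 0 < lam -> `|y| <= 1 ->
  x * y <= lam / 2 * x ^+ 2 + (2 * lam)^-1.
Proof.
move=> lam0 y1.
have mm : lam * (2 * lam)^-1 = 2^-1 by rewrite invfM mulrCA divff ?mulr1 // gt_eqF.
have y2 : y ^+ 2 <= 1 by rewrite -real_normK ?num_real // expr_le1.
rewrite -(ler_pM2l lam0) [leRHS]mulrDr mm.
by have := sqr_ge0 (lam * x - y); lra.
Qed.

(** Testing the weak derivative against the difference phi of two steps, at c1
    and c2: phi' averages U near c1 minus U near c2, while phi is bounded by 1
    and supported between them, so that g phi <= lam/2 g^2 + 1/(2 lam) there. *)
Lemma weak_derivative_steps l U g c1 c2 eps eta lam A B :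
  0 < eps -> eps < c1 < l - eps -> eps < c2 < l - eps -> 0 < lam ->
  measurable_fun `]0, l[ U ->
  (forall t, 0 < t < l -> `|t - c1| <= eps -> `|U t - A| <= eta) ->
  (forall t, 0 < t < l -> `|t - c2| <= eps -> `|U t - B| <= eta) ->
  weak_derivative l U g ->
  B - A <= 2 * eta + lam / 2 * (\int[mu]_(t in `]0, l[) (g t ^+ 2)) +
           (`|c2 - c1| + 2 * eps) / (2 * lam).
Proof.
move=> e0 /andP[c1l c1r] /andP[c2l c2r] lam0 mU UA UB [sg wd].
have [S1 [h1 [[dS1 ch1 h1p h1z] [S1b S10 S11]]]] := smooth_step c1 e0.
have [S2 [h2 [[dS2 ch2 h2p h2z] [S2b S20 S21]]]] := smooth_step c2 e0.
have l0 : 0 < l by lra.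
pose phi t := S1 t - S2 t.
have dphi t : is_derive t 1 phi (h1 t - h2 t).
  exact: is_deriveB (dS1 t) (dS2 t).
have phi'E : (phi^`())%classic = fun t => h1 t - h2 t.
  by apply/funext => t; rewrite derive1E; exact: derive_val.
have cphi : continuous phi.
  by move=> t; apply: differentiable_continuous; apply/derivable1_diffP; case: (dphi t).
have cphi' : continuous (fun t => h1 t - h2 t).
  by move=> t; apply: cvgB; [exact: ch1|exact: ch2].
have phib t : `|phi t| <= 1.
  have /andP[? ?] := S1b t; have /andP[? ?] := S2b t.
  by rewrite ler_norml /phi; apply/andP; split; lra.
pose a := Num.min c1 c2 - eps; pose b := Num.max c1 c2 + eps.
have [a1 a2] : a <= c1 - eps /\ a <= c2 - eps.
  by split; rewrite lerD2r ge_min lexx ?orbT.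
have [b1 b2] : c1 + eps <= b /\ c2 + eps <= b.
  by split; rewrite lerD2r le_max lexx ?orbT.
have a0 : 0 < a by rewrite subr_gt0 lt_min c1l c2l.
have bl : b < l by rewrite -ltrBrDr gt_max c1r c2r.
have abE : b - a = `|c2 - c1| + 2 * eps.
  by rewrite /a /b; case: (lerP c1 c2) => h; lra.
have ab : a <= b by lra.
have phi0 t : t \notin `[a, b] -> phi t = 0.
  rewrite in_itv /= negb_and -!ltNge => /orP[h|h].
    by rewrite /phi S10 ?S20 ?subr0 //; lra.
  by rewrite /phi S11 ?S21 ?subrr //; lra.
have tphi : test_function l phi.
  split; [by move=> t; case: (dphi t)|by rewrite phi'E|].
  by exists a, b; split.
have := wd phi tphi; rewrite phi'E => wdE.
(* U is nearly constant on the supports of the hats h1 and h2, of mass 1. *)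
have inth1 : \int[mu]_(t in `]0, l[) h1 t = 1.
  by rewrite (Rintegral_derivative l0 dS1 ch1) S11 ?S10 ?subr0 //; lra.
have inth2 : \int[mu]_(t in `]0, l[) h2 t = 1.
  by rewrite (Rintegral_derivative l0 dS2 ch2) S21 ?S20 ?subr0 //; lra.
pose V t := (A + eta) * h1 t - (B - eta) * h2 t.
have ch k h : continuous h -> continuous (fun t => k * h t).
  by move=> hc t; apply: cvgM; [exact: cvg_cst|exact: hc].
have cV : continuous V.
  by move=> t; apply: cvgB; exact: ch.
have Uh1 t : 0 < t < l -> `|U t * h1 t - A * h1 t| <= eta * h1 t.
  move=> ht; rewrite -mulrBl normrM (ger0_norm (h1p t)).
  have [h|h] := leP `|t - c1| eps; first by rewrite ler_wpM2r // UA.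
  by rewrite h1z // !mulr0.
have Uh2 t : 0 < t < l -> `|U t * h2 t - B * h2 t| <= eta * h2 t.
  move=> ht; rewrite -mulrBl normrM (ger0_norm (h2p t)).
  have [h|h] := leP `|t - c2| eps; first by rewrite ler_wpM2r // UB.
  by rewrite h2z // !mulr0.
have iU : mu.-integrable `]0, l[ (EFin \o (fun t => U t * (h1 t - h2 t))).
  have cW : continuous (fun t => (`|A| + eta) * h1 t + (`|B| + eta) * h2 t).
    by move=> t; apply: cvgD; exact: ch.
  apply: le_integrable (integrable_continuous l cW) => //.
    apply/measurable_EFinP; apply: measurable_funM => //.
    by apply/measurable_EFinP; case/integrableP: (integrable_continuous l cphi').
  move=> t /=; rewrite in_itv /= => ht; rewrite lee_fin.
  apply: le_trans (ler_norm _).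
  have := Uh1 t ht; have := Uh2 t ht; rewrite !ler_norml.
  have p1 := h1p t; have p2 := h2p t.
  have A1 := ler_wpM2r p1 (ler_norm A); have A2 := ler_wpM2r p1 (ler_norm (- A)).
  have B1 := ler_wpM2r p2 (ler_norm B); have B2 := ler_wpM2r p2 (ler_norm (- B)).
  rewrite normrN in A2; rewrite normrN in B2.
  by move=> /andP[? ?] /andP[? ?]; apply/andP; split; lra.
have left_le : \int[mu]_(t in `]0, l[) (U t * (h1 t - h2 t)) <= A - B + 2 * eta.
  apply: le_trans (le_Rintegral _ iU (integrable_continuous l cV) _) _ => //.
    move=> t /=; rewrite in_itv /= => ht.
    by have := Uh1 t ht; have := Uh2 t ht; rewrite !ler_norml /V; lra.
  rewrite RintegralB //; try by apply: integrable_continuous; exact: ch.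
  rewrite !RintegralZl //; try exact: integrable_continuous.
  by rewrite inth1 inth2; lra.
(* phi vanishes off [a, b]: this is where the length b - a comes from. *)
have [i1 int1] := Rintegral_indic_itv a0 ab bl.
have right_le : \int[mu]_(t in `]0, l[) (g t * phi t) <=
    lam / 2 * (\int[mu]_(t in `]0, l[) (g t ^+ 2)) + (2 * lam)^-1 * (b - a).
  have ig2 : mu.-integrable `]0, l[ (EFin \o (fun t => g t ^+ 2)) by case: sg.
  have iz1 : mu.-integrable `]0, l[ (EFin \o (fun t => lam / 2 * g t ^+ 2)).
    have h := @integrableZl _ _ _ mu _ (measurable_itv _) (lam / 2) _ ig2; exact: h.
  have iz2 : mu.-integrable `]0, l[ (EFin \o (fun t => (2 * lam)^-1 * \1_`[a, b] t)).
    have h := @integrableZl _ _ _ mu _ (measurable_itv _) (2 * lam)^-1 _ i1; exact: h.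
  rewrite -int1 -!RintegralZl // -RintegralD //.
  apply: le_Rintegral => //.
  - exact: square_integrable_mul.
  - have h := @integrableD _ _ _ mu _ (measurable_itv _) _ _ iz1 iz2; exact: h.
  move=> t _; rewrite indicE mem_setE; case: (boolP (t \in `[a, b])) => ht.
    rewrite /= mulr1.
    exact: young.
  by rewrite (phi0 t ht) !mulr0 addr0 mulr_ge0 ?sqr_ge0 // divr_ge0 // ltW.
by move: left_le right_le; rewrite wdE abE; lra.
Qed.

(** The optimal lam turns this into the Cauchy-Schwarz bound on the increment of
    U; the linear form is the one that can be summed over edges.  The steps of
    the test functions shrink onto a and b. *)
Lemma weak_derivative_le l U g a b lam :
  (forall s eta, 0 <= s <= l -> 0 < eta -> exists2 d, 0 < d &
     forall t, 0 <= t <= l -> `|t - s| < d -> `|U t - U s| <= eta) ->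
  measurable_fun `]0, l[ U -> weak_derivative l U g ->
  0 < l -> 0 < lam -> 0 <= a <= l -> 0 <= b <= l ->
  U b - U a <= lam / 2 * (\int[mu]_(t in `]0, l[) (g t ^+ 2)) +
               `|b - a| / (2 * lam).
Proof.
move=> cU mU wU l0 lam0 ha hb; apply/ler_addgt0Pr => e e0.
have eta0 : 0 < e / 4 by rewrite divr_gt0.
have [da da0 Ua] := cU a _ ha eta0; have [db db0 Ub] := cU b _ hb eta0.
pose eps := Num.min (Num.min (da / 4) (db / 4)) (Num.min (l / 4) (lam * e / 2)).
have eps0 : 0 < eps by rewrite !lt_min !divr_gt0 ?mulr_gt0.
have [e1 e2 e3 e4] : [/\ eps <= da / 4, eps <= db / 4, eps <= l / 4 &
    eps <= lam * e / 2] by split; rewrite !ge_min lexx ?orbT.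
clearbody eps.
pose k := 4 * eps / l.
have kl : k * l = 4 * eps by rewrite divfK // gt_eqF.
have k0 : 0 < k by rewrite divr_gt0 // mulr_gt0.
have k1 : k <= 1 by rewrite ler_pdivrMr // mul1r; lra.
clearbody k.
(* Steps must lie inside ]0, l[, also when a or b is an end of the interval:
   c maps [0, l] onto [2 eps, l - 2 eps]. *)
pose c s := s - s * k + 2 * eps.
have cP s : 0 <= s <= l -> eps < c s < l - eps /\ `|c s - s| <= 2 * eps.
  move=> /andP[s0 s1]; have h1 := mulr_ge0 s0 (ltW k0).
  have h2 : 0 <= (l - s) * k by rewrite mulr_ge0 ?(ltW k0) // subr_ge0.
  have h3 : 0 <= s * (1 - k) by rewrite mulr_ge0 // subr_ge0.
  have h4 : 0 <= (l - s) * (1 - k) by rewrite mulr_ge0 // subr_ge0.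
  by rewrite ler_norml /c; split; apply/andP; split; lra.
have [ca da'] := cP a ha; have [cb db'] := cP b hb.
have near s d : `|c s - s| <= 2 * eps -> eps <= d / 4 -> forall t,
    `|t - c s| <= eps -> `|t - s| < d.
  by move=> h1 h2 t; move: h1; rewrite !ler_norml ltr_norml => /andP[? ?] /andP[? ?];
    apply/andP; split; lra.
have itv t : 0 < t < l -> 0 <= t <= l by move=> /andP[? ?]; rewrite !ltW.
have := @weak_derivative_steps l U g (c a) (c b) eps (e / 4) lam (U a) (U b)
  eps0 ca cb lam0 mU _ _ wU.
move=> /(_ (fun t ht tc => Ua t (itv t ht) (near a da da' e1 t tc))).
move=> /(_ (fun t ht tc => Ub t (itv t ht) (near b db db' e2 t tc))) H.
apply: le_trans H _.
have cab : `|c b - c a| <= `|b - a|.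
  have -> : c b - c a = (b - a) * (1 - k) by rewrite /c; lra.
  by rewrite normrM ler_piMr // ler_norml; apply/andP; split; lra.
have h : (`|c b - c a| + 2 * eps) / (2 * lam) <= `|b - a| / (2 * lam) + e / 2.
  have v0 : 0 < (2 * lam)^-1 by rewrite invr_gt0 mulr_gt0.
  have -> : e / 2 = lam * e * (2 * lam)^-1.
    by rewrite invfM [2^-1 * _]mulrC mulrA [lam * e]mulrC mulfK // gt_eqF.
  by rewrite mulrDl; apply: lerD; rewrite ler_pM2r //; lra.
by lra.
Qed.

End Interval.

(** * The energy of functions on a tree *)

Section Energy.
Variables (R : realType) (G : metric_graph R).
Hypothesis acy : acyclic G.
Local Notation mu := (@lebesgue_measure R).
Implicit Types (e : edge G) (u : gpoint G -> R) (g : edge G -> R -> R)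
  (x y z p q : gpoint G) (v w : vertex G).

Lemma energyE u g : gradient u g ->
  energy g = (\sum_(e : edge G) \int[mu]_(t in `]0%R, len e[) (g e t ^+ 2))%:E.
Proof.
move=> ug; rewrite /energy -sumEFin; apply: eq_bigr => e _.
have [[_ ig] _] := ug e.
rewrite /Rintegral fineK; last exact: (integrable_fin_num _ ig).
by apply: eq_integral => t _; rewrite real_normK ?num_real.
Qed.

(** Both sides are additive along routes and agree on a segment of an edge,
    where a single coordinate moves. *)
Lemma telescope u x y : u x - u y =
  \sum_(e : edge G) (u (chart e (proj e x)) - u (chart e (proj e y))).
Proof.
have [L] := route_exists x y; elim=> [z|e s t z M hs ht _ IH].
  by rewrite subrr big1 // => e _; rewrite subrr.
rewrite -(subrKA (u (chart e t))) IH.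
rewrite -(sum_proj_chart acy (fun e' r => u (chart e' r)) hs ht) -big_split /=.
by apply: eq_bigr => e' _; rewrite subrKA.
Qed.

Lemma H1_chart_continuous u e s eta : H1 u -> 0 <= s <= len e -> 0 < eta ->
  exists2 d, 0 < d & forall t, 0 <= t <= len e -> `|t - s| < d ->
    `|u (chart e t) - u (chart e s)| <= eta.
Proof.
move=> [/continuous_gdistP uc _] hs eta0.
have [d d0 hd] := uc (chart e s) eta eta0; exists d => // t ht ts.
rewrite distrC; apply/ltW/hd; apply: le_lt_trans (gdist_le (route1 hs ht)) _.
by rewrite distrC.
Qed.

(** The edge estimates are summed with lam = d / 2, the value minimizing
    lam E / 2 + d / (2 lam) when E = 4 / d. *)
Lemma energy_ge u g p q : H1 u -> gradient u g -> u p - u q = 2 ->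
  0 < gdist p q -> ((4 / gdist p q)%:E <= energy g)%E.
Proof.
move=> hu ug upq d0; rewrite (energyE ug) lee_fin.
set d := gdist p q in d0 *; pose E e := \int[mu]_(t in `]0%R, len e[) (g e t ^+ 2).
rewrite -/(E _); have lam0 : 0 < d / 2 by rewrite divr_gt0.
have : u p - u q <= \sum_e (d / 2 / 2 * E e +
    `|proj e p - proj e q| / (2 * (d / 2))).
  rewrite telescope ler_sum // => e _.
  apply: (@weak_derivative_le R (len e) (u \o chart e) (g e)) => //.
  - by move=> s eta hs; exact: H1_chart_continuous.
  - by case: hu => _ /(_ e) [[]].
  - exact: len_gt0.
  - exact: proj_itv.
  - exact: proj_itv.
rewrite upq big_split /= -mulr_sumr -mulr_suml -/(l1dist p q) -gdistE // -/d.
have -> : 2 * (d / 2) = d by rewrite mulrC divfK.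
by rewrite divff ?gt_eqF // ler_pdivrMr //; lra.
Qed.

(** The affine function on the path from v to w, extended by constants on the
    branches: its slope 2 / d is constant on the path, as equality in the lower
    bound requires. *)
Lemma energy_attained v w : 0 < gdist (Vertex v) (Vertex w) ->
  exists u g, [/\ H1 u, gradient u g, max_is u 1, min_is u (- 1) &
    energy g = (4 / gdist (Vertex v) (Vertex w))%:E].
Proof.
set x := Vertex v; set y := Vertex w; set d := gdist x y => d0.
have dE : d = \sum_e `|proj e x - proj e y| by rewrite /d gdistE.
(* the orientation of e along the path: 1 or -1 on the path, 0 off it *)
pose k e := (proj e y - proj e x) / len e.
have kP e : [/\ `|k e| <= 1, k e ^+ 2 * len e = `|proj e x - proj e y|,
    k e * (proj e y - proj e x) = `|proj e x - proj e y| &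
    forall z, 0 <= k e * (proj e z - proj e x) <= `|proj e x - proj e y|].
  have l0 := len_gt0 e; have ll : len e / len e = 1 by rewrite divff ?gt_eqF.
  rewrite /k /=.
  have [-> | ->] := vproj_end e v; have [-> | ->] := vproj_end e w;
    rewrite ?subrr ?subr0 ?sub0r ?mul0r ?mulNr ?ll ?normrN ?normr0 ?normr1
      ?(gtr0_norm l0); split; try lra; move=> z; have /andP[] := proj_itv e z; lra.
have n0 : 0 < 2 / d by rewrite divr_gt0.
pose u z := 2 / d * (\sum_e k e * (proj e z - proj e x)) - 1.
have uB z z' : u z - u z' = 2 / d * (\sum_e (k e * proj e z - k e * proj e z')).
  rewrite /u opprB addrA subrK -mulrBr -sumrB; congr (_ * _).
  by apply: eq_bigr => e _; rewrite !mulrBr; lra.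
have ub z : u z <= 1.
  rewrite /u lerBlDr -ler_pdivlMl // invf_div mulrC mulrA.
  rewrite [X in _ <= X](_ : _ = d); last by lra.
  by rewrite dE ler_sum // => e _; have [_ _ _ /(_ z) /andP[]] := kP e.
have lb z : -1 <= u z.
  rewrite lerDr mulr_ge0 ?(ltW n0) // sumr_ge0 // => e _.
  by have [_ _ _ /(_ z) /andP[]] := kP e.
have uy : u y = 1.
  rewrite /u (_ : \sum_e _ = d); first by rewrite divfK ?gt_eqF //; lra.
  by rewrite dE; apply: eq_bigr => e _; have [_ _ ->] := kP e.
have ux : u x = -1.
  by rewrite /u big1 ?mulr0 ?sub0r // => e _; rewrite subrr mulr0.
have ulip z z' : `|u z - u z'| <= 2 / d * gdist z z'.
  rewrite uB normrM gtr0_norm // ler_pM2l // gdistE //.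
  apply: le_trans (ler_norm_sum _ _ _) _; apply: ler_sum => e _.
  rewrite -mulrBr normrM ler_piMl //; by case: (kP e).
have ucont : continuous u.
  apply/continuous_gdistP => z eps eps0; exists (eps / (2 / d)); first exact: divr_gt0.
  by move=> z' h; apply: le_lt_trans (ulip _ _) _; rewrite mulrC -ltr_pdivlMr.
have uedge e := @affine_weak_derivative R (len e) (u \o chart e)
  (u (chart e 0)) (2 / d * k e) (len_gt0 e).
have uaff e t : 0 < t < len e -> (u \o chart e) t = u (chart e 0) + 2 / d * k e * t.
  move=> /andP[t0 t1] /=; apply/eqP; rewrite addrC -subr_eq uB.
  rewrite (sum_proj_chart acy (fun e' r => k e' * r)) ?lexx ?(ltW (len_gt0 e)) ?ltW //.
  by rewrite mulr0 subr0 mulrA.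
have ug : gradient u (fun e => cst (2 / d * k e)).
  by move=> e; case: (uedge e (uaff e)).
exists u, (fun e => cst (2 / d * k e)); split => //.
- split=> // e; case: (uedge e (uaff e)) => sq wd; split=> //.
  by exists (cst (2 / d * k e)).
- by split; [exists y|move=> _ [z _ <-]].
- by split; [exists x|move=> _ [z _ <-]].
rewrite (energyE ug); congr _%:E.
transitivity (\sum_e (2 / d) ^+ 2 * `|proj e x - proj e y|).
  apply: eq_bigr => e _.
  rewrite (@Rintegral_cst _ _ _ mu _ (measurable_itv _) ((2 / d * k e) ^+ 2)).
  rewrite /= lebesgue_measure_itv /= lte_fin len_gt0 /=.
  by rewrite subr0 exprMn -mulrA; congr (_ * _); case: (kP e).
rewrite -mulr_sumr -dE expr2 mulrA divfK ?gt_eqF //; lra.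
Qed.

End Energy.

Unset Implicit Arguments.

(* mdist is the shortest-path distance of G.  The quotient is taken in the
   extended reals, with 4 / 0 = +oo (graph reduced to a single vertex). *)
Theorem proposition13 (R : realType) (G : metric_graph R)
    (G_acyclic : acyclic G) :
  exists x y : gpoint G,
    (forall x' y' : gpoint G, mdist x' y' <= mdist x y) /\
    S_infty_N G = (4%:E / (mdist x y)%:E)%E.
Proof.
have [v [w vw_max]] := diameter_vertices G_acyclic.
exists (Vertex v), (Vertex w); split; first exact: vw_max.
rewrite mdist_gdist; set d := gdist _ _.
have gap (u : gpoint G -> R) p q : u p = 1 -> u q = -1 -> 0 < gdist p q.
  move=> up uq; rewrite lt_neqAle le_gdist ?andbT; last by move=> L /route_ge0.
  apply/eqP => /esym/gdist_positivity pq; move: up; rewrite pq uq => h.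
  by have := h; lra.
have S_ge a : (exists (u : gpoint G -> R) g,
    [/\ H1 u, gradient u g, max_is u 1, min_is u (- 1) & a = energy g]) ->
    0 < d /\ ((4 / d)%:E <= a)%E.
  move=> [u [g [hu ug [[p _ up] _] [[q _ uq] _] ->]]].
  have pq := gap u p q up uq; have pqd : gdist p q <= d by exact: vw_max.
  have d0 := lt_le_trans pq pqd; split => //.
  apply: le_trans (energy_ge G_acyclic hu ug _ pq); last by rewrite up uq; lra.
  by rewrite lee_fin ler_pM2l // lef_pV2.
have [d0|d0] := eqVneq d 0.
  rewrite d0 inver eqxx gt0_muley ?lte_fin // /S_infty_N.
  rewrite (_ : [set a | _] = set0) ?ereal_inf0 //.
  by apply/seteqP; split=> // a /S_ge[]; rewrite d0 ltxx.
have d_gt0 : 0 < d.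
  by rewrite lt_neqAle eq_sym d0 le_gdist // => L /route_ge0.
rewrite inver (negbTE d0) -EFinM; apply/eqP; rewrite eq_le; apply/andP; split.
  have [u [g [hu ug umax umin <-]]] := energy_attained G_acyclic d_gt0.
  by apply: ereal_inf_lbound; exists u, g.
by apply/ereal_infP => a /S_ge[].
Qed.
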